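(* Let $\mathbb{K}$ be an infinite field and let $\mathcal{F}$ be a simultaneously orthogonalizable family of inner products on a finite-dimensional vector space $V$ over $\mathbb{K}$ with $\mathrm{rad}(\mathcal{F})=0$. Then $\mathcal{F}$ can be enlarged by adding at most one more inner product, which is a linear combination of those in $\mathcal{F}$, so that the new family has a nondegenerate inner product.
   Context: An inner product on a $\mathbb{K}$-vector space $V$ means a symmetric bilinear form $V\times V\to\mathbb{K}$ (possibly degenerate). Families are nonempty. The radical of an inner product is $\mathrm{rad}(\langle\cdot,\cdot\rangle)=\{x\in V:\langle x,y\rangle=0\ \forall y\in V\}$; the inner product is nondegenerate if its radical is $0$. The radical of a family, $\mathrm{rad}(\mathcal{F})$, is the intersection of the radicals of its members. A family is simultaneously orthogonalizable if there is a single basis $\{v_j\}$ of $V$ such that $\langle v_j,v_k\rangle=0$ whenever $j\neq k$, for every inner product in the family (isotropic basis vectors are allowed). *)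

(* Defs.v *)
(* MathComp, with sets and cardinality from MathComp-Analysis' classical layer. *)
From mathcomp Require Export all_boot all_algebra.
From mathcomp Require Export classical_sets cardinality.

Set Implicit Arguments.
Unset Strict Implicit.
Unset Printing Implicit Defensive.

Import GRing.Theory.
Local Open Scope classical_set_scope.
Local Open Scope ring_scope.

(* A possibly degenerate inner product on V is a {symmetric V}: a bilinear
   f : V -> V -> K with f x y = (-1) ^+ false * f y x, in any characteristic.
   A family of inner products is a set of them. *)

Section InnerProductFamilies.
Variables (K : fieldType) (V : vectType K).
Implicit Types (f g : {symmetric V}) (F : set {symmetric V}).

(* The library's [nondegenerate f] is by definition [radical f == 0%VS]. *)
Definition radical f : {vspace V} := orthov f fullv.

Definition family_radical F : set V := \bigcap_(f in F) [set` radical f].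

(* Nothing is required of f (tnth b i) (tnth b i), which may vanish. *)
Definition sim_orthogonalizable F : Prop :=
  exists2 b : (\dim {:V}).-tuple V, basis_of {:V} b &
    forall f, F f -> forall i j, i != j -> f (tnth b i) (tnth b j) = 0.

(* {symmetric V} carries no module structure, so that the combination is taken
   pointwise. *)
Definition linear_combination_of F g : Prop :=
  exists (n : nat) (c : 'I_n -> K) (f : 'I_n -> {symmetric V}),
    (forall i, F (f i)) /\ forall x y, g x y = \sum_(i < n) c i * f i x y.

Definition enlarged_by_at_most_one_combination F F' : Prop :=
  F' = F \/ exists2 g, linear_combination_of F g & F' = F `|` [set g].

End InnerProductFamilies.

(* Main.v *)
(** Let b be a common orthogonal basis.  Since rad(F) = 0, for each k some
    f_k in F has f_k(b_k, b_k) != 0.  The form g_t = \sum_j t^j f_j is again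
    diagonal in b, and its k-th diagonal entry is the value at t of the nonzero
    polynomial \sum_j f_j(b_k, b_k) X^j.  As K is infinite, some t is a root of
    none of these finitely many polynomials, and g_t is then nondegenerate. *)
From HB Require Import structures.
Require Import Defs.
From mathcomp Require Import finmap boolp.

Set Implicit Arguments.
Unset Strict Implicit.
Unset Printing Implicit Defensive.

Import GRing.Theory.
Local Open Scope classical_set_scope.
Local Open Scope ring_scope.

(** A nonzero [p] has fewer than [size p] distinct roots, so a finite set of at least [size p]
    points contains a nonroot. *)
Lemma infinite_exists_nonroot (K : idomainType) (p : {poly K}) :
  infinite_set [set: K] -> p != 0 -> exists t, ~~ root p t.
Proof.
move=> Kinf p0; have [B _ leB] := infinite_set_fset (size p) Kinf.
have /allPn[t _ pt] : ~~ all (root p) B.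
  apply: contraTN leB => Broots; rewrite -ltnNge.
  by apply: max_poly_roots => //; apply: fset_uniq.
by exists t.
Qed.

Section LinearCombinationOfForms.
Variables (K : fieldType) (V : vectType K) (n : nat).
Variables (c : 'I_n -> K) (f : 'I_n -> {symmetric V}).

Definition lincomb_form (x y : V) : K := \sum_(i < n) c i * f i x y.

(** The right scaling law is [idfun \; *%R] because a symmetric form is a Hermitian one whose
    conjugation is [idfun]. *)
Fact lincomb_form_bilinear :
  bilinear_for (GRing.Scale.Law.clone _ _ *%R _)
    (GRing.Scale.Law.clone _ _ (idfun \; *%R) _) lincomb_form.
Proof.
split=> [z | z] a x y; rewrite /lincomb_form /= mulr_sumr -big_split /=;
  apply: eq_bigr => i _.
- by rewrite linearPl mulrDr mulrCA.
- by rewrite linearPr mulrDr mulrCA.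
Qed.

HB.instance Definition _ := bilinear_isBilinear.Build K V V K
  (GRing.Scale.Law.clone _ _ *%R _)
  (GRing.Scale.Law.clone _ _ (idfun \; *%R) _)
  lincomb_form lincomb_form_bilinear.

Fact lincomb_form_symmetric x y :
  lincomb_form x y = (-1) ^+ false * idfun (lincomb_form y x).
Proof.
rewrite expr0 mul1r /=; apply: eq_bigr => i _; congr (_ * _).
by rewrite hermitian_subproof expr0 mul1r.
Qed.

HB.instance Definition _ :=
  isHermitianSesquilinear.Build K V false idfun lincomb_form
    lincomb_form_symmetric.

Definition lincomb_symmetric : {symmetric V} := lincomb_form.

End LinearCombinationOfForms.

Section OrthogonalBasis.
Variables (K : fieldType) (V : vectType K) (b : (\dim {:V}).-tuple V).
Hypothesis b_basis : basis_of {:V} b.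

Definition orthogonal_for (f : {symmetric V}) :=
  forall i j, i != j -> f (tnth b i) (tnth b j) = 0.

Lemma orthogonal_for_lincomb n (c : 'I_n -> K) (f : 'I_n -> {symmetric V}) :
  (forall i, orthogonal_for (f i)) -> orthogonal_for (lincomb_symmetric c f).
Proof.
move=> f_orth i j ij; rewrite /= /lincomb_form big1 // => k _.
by rewrite f_orth ?mulr0.
Qed.

Variable f : {symmetric V}.
Hypothesis f_orth : orthogonal_for f.

(** In the expansion of [v] along [b], orthogonality kills every term but the [i]-th. Hence the
    diagonal entries alone decide which vectors are in the radical. *)
Lemma orthogonal_basis_formE i v :
  f v (tnth b i) = coord b i v * f (tnth b i) (tnth b i).
Proof.
rewrite {1}(coord_basis b_basis (memvf v)) linear_sumlz (bigD1 i) //= big1.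
  by rewrite addr0 linearZl_LR (tnth_nth 0).
by move=> j ji; rewrite linearZl_LR /= -(tnth_nth 0) f_orth ?mulr0.
Qed.

Lemma orthogonal_basis_radical i :
  f (tnth b i) (tnth b i) = 0 -> tnth b i \in radical f.
Proof.
move=> fii; apply/mem_orthovP => v _.
by rewrite hermitian_subproof /= orthogonal_basis_formE fii !mulr0.
Qed.

(** Pairing a radical vector with [tnth b i] gives its [i]-th coordinate times a nonzero scalar, so
    all its coordinates vanish. *)
Lemma orthogonal_basis_nondegenerate :
  (forall i, f (tnth b i) (tnth b i) != 0) -> nondegenerate f.
Proof.
move=> f_diag; rewrite /nondegenerate -subv0; apply/subvP => v /mem_orthovP v_rad.
rewrite memv0 (coord_basis b_basis (memvf v)) big1 // => i _.
have /eqP := v_rad (tnth b i) (memvf _).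
rewrite orthogonal_basis_formE mulf_eq0 (negPf (f_diag i)) orbF => /eqP ->.
by rewrite scale0r.
Qed.

End OrthogonalBasis.

Theorem corollary2 (K : fieldType) (V : vectType K) (F : set {symmetric V}) :
  infinite_set [set: K] ->
  F !=set0 ->
  sim_orthogonalizable F ->
  family_radical F = [set 0] ->
  exists2 F' : set {symmetric V},
    enlarged_by_at_most_one_combination F F' &
    exists2 h : {symmetric V}, F' h & nondegenerate h.
Proof.
move=> Kinf _ [b b_basis b_orth] radF.
have nonisotropic k : exists f : {symmetric V},
    F f /\ f (tnth b k) (tnth b k) != 0.
  apply: contrapT => noF.
  (* If every member of [F] vanished at the basis vector [b_k], this nonzero vector would lie in all
     the radicals. *)
  have /eqP[] := free_not0 (basis_free b_basis) (mem_tnth k b).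
  suff : family_radical F (tnth b k) by rewrite radF.
  move=> f Ff; apply: (orthogonal_basis_radical b_basis (b_orth f Ff)).
  by apply/eqP; apply: contrapT => /negP fk; apply: noF; exists f.
have [f fP] := choice nonisotropic.
pose p k := rVpoly (\row_j f j (tnth b k) (tnth b k)).
(* The coefficient of index [k] in [p k] is [f_k(b_k, b_k)], nonzero by the choice of [f_k]. *)
have p_neq0 k : p k != 0.
  apply: contraNneq (fP k).2 => /(congr1 (fun q : {poly K} => q`_k)).
  by rewrite coef_rVpoly_ord mxE coef0 => ->.
(* A nonroot of the product is a nonroot of every [p k] at once. *)
have prod_neq0 : \prod_k p k != 0 by apply/prodf_neq0 => k _; exact: p_neq0.
have [t] := infinite_exists_nonroot Kinf prod_neq0.
rewrite rootE horner_prod => /prodf_neq0 p_t.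
pose g := lincomb_symmetric (fun j : 'I_(\dim {:V}) => t ^+ j) f.
have g_orth : orthogonal_for b g.
  by apply: orthogonal_for_lincomb => j; exact: b_orth (fP j).1.
(* No case split is made: [g] is adjoined even if [F] already has a nondegenerate member. *)
exists (F `|` [set g]).
  right; exists g => //; exists (\dim {:V}), (fun j => t ^+ j), f.
  by split=> // j; exact: (fP j).1.
exists g; first by right.
apply: (orthogonal_basis_nondegenerate b_basis g_orth) => k.
suff -> : g (tnth b k) (tnth b k) = (p k).[t] by exact: p_t.
(* [rVpoly] reads its coefficients through [insub], with default 0; [valK] resolves it for ordinal
   indices. *)
rewrite horner_poly; apply: eq_bigr => j _.
by rewrite valK mxE mulrC.
Qed.
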